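(* Let $R=R_1\times\cdots\times R_s$ be a finite product of commutative rings with identity, with structural idempotents $e_i\in R$, and let $A(z)$ and $B(z)$ be matrices of sizes $p\times q_1$ and $p\times q_2$ respectively with entries in $R[z]$. Then $$\ker(A(z)\mid B(z))=\{u(z)\mid\exists x(z):A(z)x(z)+B(z)u(z)=0\}=e_1\ker(\pi_1(A)(z)\mid\pi_1(B)(z))+\cdots+e_s\ker(\pi_s(A)(z)\mid\pi_s(B)(z)).$$
   Context: For a commutative ring $T$ and matrices $A(z)\in T[z]^{p\times q_1}$, $B(z)\in T[z]^{p\times q_2}$, $\ker(A(z)\mid B(z))=\{u(z)\in T[z]^{q_2}\mid\exists x(z)\in T[z]^{q_1}: A(z)x(z)+B(z)u(z)=0\}$. Here $\pi_i:R\to R_i$ is the projection onto the $i$th factor, $\pi_i(A)(z)\in R_i[z]^{p\times q_1}$ is the matrix obtained from $A(z)$ by applying $\pi_i$ to all coefficients of all entries (similarly for $B$), and $e_i=(0,\dots,0,1,0,\dots,0)\in R$ is the $i$th structural idempotent (with $1$ in position $i$). Under the identification $R_i[z]\cong e_iR[z]$, for a subset $V\subseteq R_i[z]^{q_2}$ the notation $e_iV$ denotes the corresponding subset of $(e_iR[z])^{q_2}\subseteq R[z]^{q_2}$, i.e. the set of $e_i\tilde v$ where $\tilde v\in R[z]^{q_2}$ is any vector with $\pi_i(\tilde v)\in V$ (coefficientwise). *)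

(* Defs.v *)
From HB Require Import structures.
From mathcomp Require Import all_boot all_algebra.
From mathcomp Require Import boolp classical_sets.

Set Implicit Arguments.
Unset Strict Implicit.
Unset Printing Implicit Defensive.

Import GRing.Theory.
Local Open Scope ring_scope.
Local Open Scope classical_set_scope.

(* The product ring R_0 x ... x R_n, for n.+1 commutative rings: [{poly _}]
   needs 1 != 0, so the factors are nontrivial and there is at least one. *)
Definition prodring (n : nat) (R : 'I_n.+1 -> comNzRingType) : Type :=
  {dffun forall i : 'I_n.+1, R i}.

Section ProdRing.
Variables (n : nat) (R : 'I_n.+1 -> comNzRingType).
Local Notation P := (prodring R).

HB.instance Definition _ := Choice.on P.

Definition prodring0 : P := [ffun i : 'I_n.+1 => 0 : R i].
Definition prodring1 : P := [ffun i : 'I_n.+1 => 1 : R i].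
Definition prodring_opp (f : P) : P := [ffun i : 'I_n.+1 => - f i].
Definition prodring_add (f g : P) : P := [ffun i : 'I_n.+1 => f i + g i].
Definition prodring_mul (f g : P) : P := [ffun i : 'I_n.+1 => f i * g i].

Fact prodring_addA : associative prodring_add.
Proof. by move=> f g h; apply/ffunP => i; rewrite !ffunE addrA. Qed.
Fact prodring_addC : commutative prodring_add.
Proof. by move=> f g; apply/ffunP => i; rewrite !ffunE addrC. Qed.
Fact prodring_add0 : left_id prodring0 prodring_add.
Proof. by move=> f; apply/ffunP => i; rewrite !ffunE add0r. Qed.
Fact prodring_addN : left_inverse prodring0 prodring_opp prodring_add.
Proof. by move=> f; apply/ffunP => i; rewrite !ffunE addNr. Qed.

HB.instance Definition _ := GRing.isZmodule.Build P
  prodring_addA prodring_addC prodring_add0 prodring_addN.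

Fact prodring_mulA : associative prodring_mul.
Proof. by move=> f g h; apply/ffunP => i; rewrite !ffunE mulrA. Qed.
Fact prodring_mulC : commutative prodring_mul.
Proof. by move=> f g; apply/ffunP => i; rewrite !ffunE mulrC. Qed.
Fact prodring_mul1 : left_id prodring1 prodring_mul.
Proof. by move=> f; apply/ffunP => i; rewrite !ffunE mul1r. Qed.
Fact prodring_mulD : left_distributive prodring_mul +%R.
Proof. by move=> f g h; apply/ffunP => i; rewrite !ffunE mulrDl. Qed.
Fact prodring1_neq0 : prodring1 != 0.
Proof. by apply/eqP => /ffunP/(_ ord0)/eqP; rewrite !ffunE oner_eq0. Qed.

HB.instance Definition _ := GRing.Zmodule_isComNzRing.Build P
  prodring_mulA prodring_mulC prodring_mul1 prodring_mulD prodring1_neq0.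

Definition prodring_proj (i : 'I_n.+1) (f : P) : R i := f i.

Fact prodring_proj_is_zmod_morphism i : zmod_morphism (prodring_proj i).
Proof. by move=> f g; rewrite /prodring_proj !ffunE. Qed.
Fact prodring_proj_is_monoid_morphism i : monoid_morphism (prodring_proj i).
Proof. by split=> [|f g]; rewrite /prodring_proj !ffunE. Qed.

HB.instance Definition _ i := GRing.isZmodMorphism.Build P (R i)
  (prodring_proj i) (prodring_proj_is_zmod_morphism i).
HB.instance Definition _ i := GRing.isMonoidMorphism.Build P (R i)
  (prodring_proj i) (prodring_proj_is_monoid_morphism i).

Definition prodring_idem (i : 'I_n.+1) : P :=
  [ffun j : 'I_n.+1 => (j == i)%:R : R j].

(* [pi_i] applied to every coefficient of every entry of a matrix over R[z]. *)
Definition prodring_proj_mx (i : 'I_n.+1) (p q : nat) (A : 'M[{poly P}]_(p, q)) :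
    'M[{poly (R i)}]_(p, q) :=
  map_mx (map_poly (prodring_proj i)) A.

(* [e_i V], as a set of vectors over R[z]: all the e_i v with pi_i(v) in V. *)
Definition idem_set (i : 'I_n.+1) (q : nat) (V : set 'cV[{poly (R i)}]_q) :
    set 'cV[{poly P}]_q :=
  (fun v : 'cV[{poly P}]_q => (prodring_idem i)%:P *: v)
    @` (@prodring_proj_mx i q 1 @^-1` V).

End ProdRing.

Definition kerpair (T : comNzRingType) (p q1 q2 : nat)
    (A : 'M[{poly T}]_(p, q1)) (B : 'M[{poly T}]_(p, q2)) :
    set 'cV[{poly T}]_q2 :=
  [set u | exists x : 'cV[{poly T}]_q1, A *m x + B *m u = 0].

(* The Minkowski sum of a finite family of subsets. *)
Definition sumset (V : nmodType) (m : nat) (S : 'I_m -> set V) : set V :=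
  [set u | exists v : 'I_m -> V, (forall i, S i (v i)) /\ u = \sum_i v i].

(* Main.v *)
Require Import Defs.
From HB Require Import structures.
From mathcomp Require Import all_boot all_algebra.
From mathcomp Require Import boolp classical_sets.

Set Implicit Arguments.
Unset Strict Implicit.
Unset Printing Implicit Defensive.

Import GRing.Theory.
Local Open Scope ring_scope.
Local Open Scope classical_set_scope.

(** Since [e_1 + ... + e_s = 1], every [u] is the sum of the [e_i u], and
    applying the ring morphism [pi_i] to [A x + B u = 0] shows that [pi_i u]
    lies in the i-th kernel: this is the inclusion from left to right.

    Conversely, let [pi_i w] lie in the i-th kernel, with witness [y] over
    [R_i[z]].  As [pi_i] is onto ([prodring_proj_mx_surj]), [y] is [pi_i x] for
    some [x] over [R[z]], so [pi_i] kills [A x + B w].  The kernel of [pi_i] is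
    the annihilator of [e_i] ([idem_scale_eq0]), so [e_i] times [A x + B w] is
    zero and [e_i x] witnesses that [e_i w] lies in the kernel over [R[z]];
    these elements are then added up, the kernel being closed under sums
    ([kerpair_sum]). *)

Section ProdRingMatrices.
Variables (n : nat) (R : 'I_n.+1 -> comNzRingType).
Local Notation P := (prodring R).

Lemma sum_prodring_idem : \sum_(i < n.+1) prodring_idem R i = 1.
Proof.
apply/ffunP => j.
rewrite -[LHS]/(prodring_proj j _) raddf_sum /= (bigD1 j) //= big1 => [|i].
  by rewrite addr0 /prodring_proj !ffunE eqxx.
by rewrite /prodring_proj ffunE eq_sym => /negbTE ->.
Qed.

Lemma sum_idem_scale q (u : 'cV[{poly P}]_q) :
  \sum_(i < n.+1) (prodring_idem R i)%:P *: u = u.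
Proof. by rewrite -scaler_suml -raddf_sum sum_prodring_idem scale1r. Qed.

(** A coefficient of [e_i M] vanishes at the positions other than [i] because
    [e_i] does, and at [i] because [M] does. *)
Lemma idem_scale_eq0 i p q (M : 'M[{poly P}]_(p, q)) :
  prodring_proj_mx i M = 0 -> (prodring_idem R i)%:P *: M = 0.
Proof.
move=> M0; apply/matrixP => a b; rewrite !mxE; apply/polyP => k.
rewrite coefCM coef0; apply/ffunP => j; rewrite !ffunE.
have [->|_] := eqVneq j i; last by rewrite mul0r.
have /polyP/(_ k) := congr1 (fun N : 'M_(p, q) => N a b) M0.
rewrite !mxE coef_map coef0 /= /prodring_proj => ->.
by rewrite mulr0.
Qed.

(** Preimages are found coefficientwise, by padding with zeros in the other
    factors.  Padding fixes 0, so [map_poly] of it acts as padding on every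
    coefficient, including those beyond the size of the polynomial. *)
Lemma prodring_proj_mx_surj i p q (N : 'M[{poly R i}]_(p, q)) :
  exists M : 'M[{poly P}]_(p, q), prodring_proj_mx i M = N.
Proof.
pose pad (a : R i) : P := [ffun j => dfwith (fun j => 0 : R j) a j].
have pad0 : pad 0 = 0.
  by apply/ffunP => j; rewrite !ffunE; case: dfwithP.
exists (map_mx (map_poly pad) N); apply/matrixP => a b; rewrite !mxE.
apply/polyP => k; rewrite coef_map coef_map_id0 //.
by rewrite /= /prodring_proj ffunE dfwith_in.
Qed.

Lemma prodring_proj_mxD i p q :
  {morph @prodring_proj_mx n R i p q : M N / M + N}.
Proof. exact: map_mxD. Qed.

Lemma prodring_proj_mxM i p q r (M : 'M[{poly P}]_(p, q))
    (N : 'M[{poly P}]_(q, r)) :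
  prodring_proj_mx i (M *m N) = prodring_proj_mx i M *m prodring_proj_mx i N.
Proof. exact: map_mxM. Qed.

End ProdRingMatrices.

Lemma kerpair_sum (T : comNzRingType) p q1 q2 (A : 'M[{poly T}]_(p, q1))
    (B : 'M[{poly T}]_(p, q2)) (I : finType) (v : I -> 'cV[{poly T}]_q2) :
  (forall i, kerpair A B (v i)) -> kerpair A B (\sum_i v i).
Proof.
move=> kv; elim/big_ind: _ => [|u w [x xP] [y yP]|i _]; last exact: kv.
  by exists 0; rewrite !mulmx0 addr0.
by exists (x + y); rewrite !mulmxDr addrACA xP yP addr0.
Qed.

Theorem corollary5p4 (n : nat) (R : 'I_n.+1 -> comNzRingType) (p q1 q2 : nat)
    (A : 'M[{poly (prodring R)}]_(p, q1)) (B : 'M[{poly (prodring R)}]_(p, q2)) :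
  kerpair A B =
    sumset (fun i : 'I_n.+1 =>
      idem_set (kerpair (prodring_proj_mx i A) (prodring_proj_mx i B))).
Proof.
apply/seteqP; split=> [u [x xP]|_ [v [vP ->]]].
  exists (fun i => (prodring_idem R i)%:P *: u); split; last first.
    by rewrite sum_idem_scale.
  move=> i; exists u => //; exists (prodring_proj_mx i x).
  by rewrite -!prodring_proj_mxM -prodring_proj_mxD xP; exact: map_mx0.
apply: kerpair_sum => i.
have [w [y yP] <-] := vP i.
have [x xE] := prodring_proj_mx_surj y.
exists ((prodring_idem R i)%:P *: x).
rewrite -!scalemxAr -scalerDr; apply: idem_scale_eq0.
by rewrite prodring_proj_mxD !prodring_proj_mxM xE.
Qed.
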